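(* Fix $\epsilon>0$. There is a sampler $\texttt{TS}_\epsilon:\mathbb{N}\times\mathbb{R}_+^N\to 2^{[N]}$ such that for any $k\in\mathbb{N}$ with $k\le N$ and any undirected weighted graph $G$ on $n$ vertices with weight vector $w\in\mathbb{R}_+^N$, $\texttt{TS}_\epsilon(k,w)$ outputs an edge set $S\subseteq[N]$ with $|S|=k$ distributed according to $$\pi(S)\propto\prod_{e\in S}\exp(\epsilon\, w_e)\qquad (S\subseteq[N],\ |S|=k).$$ Further, $\texttt{TS}_\epsilon$ runs in time $O(kn^2)$.
   Context: $N=\binom{n}{2}$, and the $N$ unordered pairs of distinct vertices of the vertex set $V$ ($|V|=n$) are identified with $[N]=\{1,\dots,N\}$. A weighted graph $G=(V,E,w)$ is identified with its weight vector $w\in\mathbb{R}_+^N$, where $w_e$ is the weight of pair $e$ ($w_e=0$ if $e$ is not an edge). Running time is measured in arithmetic operations and elementary random draws. *)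

(* Defs.v *)
From HB Require Import structures.
From mathcomp Require Import all_boot all_order all_algebra.
From mathcomp Require Import reals sequences exp.

Set Implicit Arguments.
Unset Strict Implicit.
Unset Printing Implicit Defensive.

Import Order.TTheory GRing.Theory Num.Theory.

Local Open Scope ring_scope.

(** * Randomized computations

   [Tick m t] spends [m] units of time and continues as [t]; [Coin p t f] is a
   random draw that continues as [t] iff a uniform point of [0, 1] falls
   below [p]. *)

Inductive rcomp (R A : Type) : Type :=
| Leaf of A
| Tick of nat & rcomp R A
| Coin of R & rcomp R A & rcomp R A.

Arguments Leaf {R A} _.

Fixpoint rbind (R A B : Type) (t : rcomp R A) (f : A -> rcomp R B) :
    rcomp R B :=
  match t with
  | Leaf a => f a
  | Tick m t => Tick m (rbind t f)
  | Coin p t1 t2 => Coin p (rbind t1 f) (rbind t2 f)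
  end.

(* The probability that a uniform point of [0, 1] falls below [p]. *)
Definition clamp (R : realType) (p : R) : R := Num.max 0 (Num.min 1 p).

Fixpoint prob (R : realType) (A : Type) (E : pred A) (t : rcomp R A) : R :=
  match t with
  | Leaf a => (E a)%:R
  | Tick _ t => prob E t
  | Coin p t1 t2 => clamp p * prob E t1 + (1 - clamp p) * prob E t2
  end.

(* Worst case over all outcomes of the draws. *)
Fixpoint time (R A : Type) (t : rcomp R A) : nat :=
  match t with
  | Leaf _ => 0
  | Tick m t => m + time t
  | Coin _ t1 t2 => maxn (time t1) (time t2)
  end%N.

(** * A randomized real RAM, as a structured language

   Programs are finite pieces of syntax, independent of the input. The memory
   has natural-number variables, used for indexing and loop control, and
   arrays of real numbers; variables and arrays are named by numbers. There is
   no conversion from reals to naturals other than through comparisons and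
   coin tosses. *)

Inductive nexp : Type :=
| NLit of nat
| NVar of nat
| NAdd of nexp & nexp
| NSub of nexp & nexp
| NMul of nexp & nexp.

Inductive rexp : Type :=
| RLit of nat
| RGet of nat & nexp (* array name, index *)
| RAdd of rexp & rexp
| RSub of rexp & rexp
| RMul of rexp & rexp
| RDiv of rexp & rexp
| RExp of rexp.

Inductive bexp : Type :=
| NLt of nexp & nexp
| RLt of rexp & rexp.

Inductive cmd : Type :=
| Skip
| Seq of cmd & cmd
| SetN of nat & nexp
| SetR of nat & nexp & rexp (* array name, index, value *)
| Toss of nat & rexp (* variable := 1 with the given probability, else 0 *)
| Select of nexp (* add an index to the output set *)
| If of bexp & cmd & cmd
| For of nat & nexp & cmd. (* for variable = 0, ..., bound - 1 *)

Record state (R : Type) : Type := State {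
  nvar : nat -> nat;
  rarr : nat -> nat -> R;
  selected : nat -> bool
}.

Definition upd (T : Type) (f : nat -> T) (x : nat) (v : T) : nat -> T :=
  fun y => if y == x then v else f y.

Definition set_nvar (R : Type) (s : state R) (x v : nat) : state R :=
  State (upd (nvar s) x v) (rarr s) (selected s).

Definition set_rarr (R : Type) (s : state R) (a i : nat) (v : R) : state R :=
  State (nvar s) (upd (rarr s) a (upd (rarr s a) i v)) (selected s).

Definition set_selected (R : Type) (s : state R) (i : nat) : state R :=
  State (nvar s) (rarr s) (upd (selected s) i true).

Fixpoint neval (R : Type) (s : state R) (e : nexp) : nat :=
  match e with
  | NLit m => m
  | NVar x => nvar s x
  | NAdd a b => neval s a + neval s b
  | NSub a b => neval s a - neval s b
  | NMul a b => neval s a * neval s b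
  end%N.

Fixpoint reval (R : realType) (s : state R) (e : rexp) : R :=
  match e with
  | RLit m => m%:R
  | RGet a i => rarr s a (neval s i)
  | RAdd a b => reval s a + reval s b
  | RSub a b => reval s a - reval s b
  | RMul a b => reval s a * reval s b
  | RDiv a b => reval s a / reval s b
  | RExp a => expR (reval s a)
  end.

Definition beval (R : realType) (s : state R) (b : bexp) : bool :=
  match b with
  | NLt a b => (neval s a < neval s b)%N
  | RLt a b => reval s a < reval s b
  end.

(* Every operation, literal and memory access in an expression costs one. *)

Fixpoint ncost (e : nexp) : nat :=
  match e with
  | NLit _ | NVar _ => 1
  | NAdd a b | NSub a b | NMul a b => (ncost a + ncost b).+1
  end%N.

Fixpoint rcost (e : rexp) : nat :=
  match e with
  | RLit _ => 1
  | RGet _ i => (ncost i).+1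
  | RAdd a b | RSub a b | RMul a b | RDiv a b => (rcost a + rcost b).+1
  | RExp a => (rcost a).+1
  end%N.

Definition bcost (b : bexp) : nat :=
  match b with
  | NLt a b => (ncost a + ncost b).+1
  | RLt a b => (rcost a + rcost b).+1
  end%N.

(* [run_for body x i m s] runs the iterations [i, ..., i + m - 1]; each costs
   one more than its body. *)
Fixpoint run_for (R : Type) (body : state R -> rcomp R (state R))
    (x i m : nat) (s : state R) : rcomp R (state R) :=
  if m is m'.+1 then
    Tick 1 (rbind (body (set_nvar s x i)) (run_for body x i.+1 m'))
  else Leaf s.

Fixpoint exec (R : realType) (c : cmd) (s : state R) : rcomp R (state R) :=
  match c with
  | Skip => Tick 1 (Leaf s)
  | Seq c1 c2 => rbind (exec c1 s) (exec c2)
  | SetN x e => Tick (ncost e).+1 (Leaf (set_nvar s x (neval s e)))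
  | SetR a i e =>
      Tick (ncost i + rcost e).+1%N
        (Leaf (set_rarr s a (neval s i) (reval s e)))
  | Toss x p =>
      Tick (rcost p).+1
        (Coin (reval s p) (Leaf (set_nvar s x 1%N)) (Leaf (set_nvar s x 0%N)))
  | Select i => Tick (ncost i).+1 (Leaf (set_selected s (neval s i)))
  | If b c1 c2 =>
      Tick (bcost b).+1 (if beval s b then exec c1 s else exec c2 s)
  | For x e c =>
      Tick (ncost e).+1 (run_for (exec c) x 0%N (neval s e) s)
  end.

(* Input: [k] in variable 0, [N] in variable 1, [w] in array 0, [eps] in cell 0
   of array 1; all other memory is zero and no index is selected. *)
Definition input (R : realType) (eps : R) (N k : nat) (w : 'I_N -> R) :
    state R :=
  State
    (fun x => if x == 0%N then k else if x == 1%N then N else 0%N)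
    (fun a i =>
       if a == 0%N then oapp w 0 (insub i)
       else if (a == 1%N) && (i == 0%N) then eps else 0)
    (fun _ => false).

Definition output (R : Type) (N : nat) (s : state R) : {set 'I_N} :=
  [set e : 'I_N | selected s e].

Definition sample (R : realType) (P : cmd) (eps : R) (N k : nat)
    (w : 'I_N -> R) : rcomp R {set 'I_N} :=
  rbind (exec P (input eps k w)) (fun s => Leaf (output N s)).

(** * The target distribution *)

Definition expweight (R : realType) (eps : R) (N : nat) (w : 'I_N -> R)
    (S : {set 'I_N}) : R :=
  \prod_(e in S) expR (eps * w e).

Definition target (R : realType) (eps : R) (N k : nat) (w : 'I_N -> R)
    (S : {set 'I_N}) : R :=
  if #|S| == k then
    expweight eps w S / \sum_(T : {set 'I_N} | #|T| == k) expweight eps w T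
  else 0.

(* Main.v *)
(** Let [x_e = exp (eps w_e)], and let [e_j(m)] be the [j]-th elementary
   symmetric polynomial in [x_0, ..., x_(m-1)]. By the recurrence
   [e_j(m+1) = e_j(m) + x_m e_(j-1)(m)], one array of [k + 1] numbers can be
   updated in place, in time [O(k)], to insert a weight and also to remove it
   again. After all [N] weights are inserted, they are removed in reverse order;
   when [x_m] is removed and [r] elements are still to be chosen, [m] is selected
   with probability [x_m e_(r-1)(m) / e_r(m+1)]. These conditional probabilities
   telescope to [prod_(e in S) x_e / e_k(N)]. *)

Require Import Defs.
From HB Require Import structures.
From mathcomp Require Import all_boot all_order all_algebra.
From mathcomp Require Import reals sequences exp.
From mathcomp Require Import zify ring.

Import Order.TTheory GRing.Theory Num.Theory.

Local Open Scope ring_scope.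

Set Implicit Arguments.
Unset Strict Implicit.

(** * General facts on randomized computations *)

Lemma prob_rbind_leaf (R : realType) (A B : Type) (E : pred B) (g : A -> B)
    (t : rcomp R A) :
  prob E (rbind t (fun a => Leaf (g a))) = prob (fun a => E (g a)) t.
Proof. by elim: t => //= p t1 -> t2 ->. Qed.

Lemma time_rbind_leaf (R A B : Type) (g : A -> B) (t : rcomp R A) :
  time (rbind t (fun a => Leaf (g a))) = time t.
Proof. by elim: t => //= [m t ->|p t1 -> t2 ->]. Qed.

Lemma rbindA (R A B C : Type) (t : rcomp R A) (f : A -> rcomp R B)
    (g : B -> rcomp R C) :
  rbind (rbind t f) g = rbind t (fun a => rbind (f a) g).
Proof. by elim: t => //= [m t ->|p t1 -> t2 ->]. Qed.

Lemma sum_prob_pred1 (R : realType) (A : finType) (t : rcomp R A) :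
  \sum_(a : A) prob (pred1 a) t = 1.
Proof.
elim: t => //= [a|p t1 IH1 t2 IH2].
  rewrite (bigD1 a) //= eqxx big1 ?addr0 // => b /negPf ba.
  by rewrite eq_sym ba.
by rewrite big_split /= -!mulr_sumr IH1 IH2 !mulr1 addrC subrK.
Qed.

(* The normalising constant need not be computed: total mass one forces it. *)
Lemma target_of_proportional (R : realType) (eps : R) (N k : nat)
    (w : 'I_N -> R) (t : rcomp R {set 'I_N}) (c : R) :
  c != 0 ->
  (forall S, prob (pred1 S) t =
     if #|S| == k then expweight eps w S / c else 0) ->
  forall S, prob (pred1 S) t = target eps k w S.
Proof.
move=> c0 pt S; rewrite pt /target; case: ifP => // _; congr (_ / _).
have := sum_prob_pred1 t; under eq_bigr do rewrite pt.
rewrite -big_mkcond /= -mulr_suml => /(congr1 ( *%R^~ c)).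
by rewrite mul1r divfK.
Qed.

(** * A Hoare-style calculus with cost budgets for coin-free code *)

Fixpoint det (R A : Type) (t : rcomp R A) (c : nat) (Q : A -> Prop) : Prop :=
  match t with
  | Leaf a => Q a
  | Tick m t => (m <= c)%N /\ det t (c - m)%N Q
  | Coin _ _ _ => False
  end.

(** Without coins there is a single final state, so whatever follows can be analysed from it alone.
    This removes the table loops from the probabilistic argument. *)
Lemma det_run (R : realType) (A : Type) (t : rcomp R A) (c : nat)
    (Q : A -> Prop) :
  det t c Q ->
  exists a, [/\ Q a,
    forall B (E : pred B) f, prob E (rbind t f) = prob E (f a) &
    forall B (f : A -> rcomp R B), (time (rbind t f) <= c + time (f a))%N].
Proof.
elim: t c => //= [a|m t IH] c.
  by move=> Qa; exists a; split=> // B f; lia.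
case=> mc /IH [a [Qa pa ta]]; exists a; split=> // B f.
by have := ta B f; lia.
Qed.

Lemma det_weaken (R A : Type) (t : rcomp R A) (c c' : nat) (Q Q' : A -> Prop) :
  (c <= c')%N -> (forall a, Q a -> Q' a) -> det t c Q -> det t c' Q'.
Proof.
move=> + QQ'; elim: t c c' => //= [a|m t IH] c c' cc'; first exact: QQ'.
by case=> mc dt; split; [lia | apply: IH dt; lia].
Qed.

Lemma det_rbind (R A B : Type) (t : rcomp R A) (f : A -> rcomp R B)
    (c c' : nat) (Q : A -> Prop) (Q' : B -> Prop) :
  det t c Q -> (forall a, Q a -> det (f a) c' Q') ->
  det (rbind t f) (c + c')%N Q'.
Proof.
move=> + df; elim: t c => //= [a|m t IH] c.
  by move=> /df; apply: det_weaken => //; lia.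
case=> mc /IH dt; split; first lia.
by rewrite -addnBAC.
Qed.

Lemma det_run_for (R : Type) (body : state R -> rcomp R (state R))
    (I : nat -> state R -> Prop) (x c lo m : nat) (s : state R) :
  (forall i s, (lo <= i < lo + m)%N -> I i s ->
     det (body (set_nvar s x i)) c (I i.+1)) ->
  I lo s -> det (run_for body x lo m s) (m * c.+1)%N (I (lo + m)%N).
Proof.
elim: m lo s => [|m IH] lo s Ibody Is /=; first by rewrite addn0.
split; first lia.
have -> : (m.+1 * c.+1 - 1 = c + m * c.+1)%N by lia.
apply: (@det_rbind _ _ _ _ _ _ _ (I lo.+1)); first by apply: Ibody => //; lia.
move=> s' Is'; rewrite -addSnnS; apply: IH => // i s'' ilo.
by apply: Ibody; lia.
Qed.

Lemma det_For (R : realType) (body : cmd) (I : nat -> state R -> Prop)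
    (x c m : nat) (e : nexp) (s : state R) :
  neval s e = m ->
  (forall i s, (i < m)%N -> I i s ->
     det (exec body (set_nvar s x i)) c (I i.+1)) ->
  I 0%N s -> det (exec (For x e body) s) ((ncost e).+1 + m * c.+1)%N (I m).
Proof.
move=> em Ibody I0; split; first exact: leq_addr.
by rewrite addKn em; apply: (@det_run_for _ _ I).
Qed.

(** * Elementary symmetric polynomials *)

(* [esym x m j.+1] is the [j]-th elementary symmetric polynomial in
   [x 0, ..., x m.-1]; the shift makes [esym x m 0 = 0] absorb the boundary case
   of the recurrence. *)
Fixpoint esym (R : realType) (x : nat -> R) (m j : nat) : R :=
  match m, j with
  | _, 0%N => 0
  | 0%N, j'.+1 => (j' == 0%N)%:R
  | m'.+1, j'.+1 => esym x m' j'.+1 + x m' * esym x m' j'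
  end.

Lemma esym0 (R : realType) (x : nat -> R) (m : nat) : esym x m 0 = 0.
Proof. by case: m. Qed.

Lemma esymS (R : realType) (x : nat -> R) (m j : nat) :
  esym x m.+1 j.+1 = esym x m j.+1 + x m * esym x m j.
Proof. by []. Qed.

Lemma esym_ge0 (R : realType) (x : nat -> R) (m j : nat) :
  (forall i, 0 < x i) -> 0 <= esym x m j.
Proof.
move=> x0; elim: m j => [|m IH] [|j] //=.
by rewrite addr_ge0 // mulr_ge0 // ltW.
Qed.

Lemma esym_gt0 (R : realType) (x : nat -> R) (m j : nat) :
  (forall i, 0 < x i) -> (j <= m)%N -> 0 < esym x m j.+1.
Proof.
move=> x0; elim: m j => [|m IH] [|j] //= jm.
  by rewrite esym0 mulr0 addr0 IH.
by rewrite ltr_wpDl ?esym_ge0 // mulr_gt0 // IH.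
Qed.

Lemma esym_eq0 (R : realType) (x : nat -> R) (m j : nat) :
  (m < j)%N -> esym x m j.+1 = 0.
Proof.
elim: m j => [|m IH] [|j] //= jm.
by rewrite !IH ?mulr0 ?addr0 //; lia.
Qed.

(** * The program *)

Definition xexp (i : nexp) : rexp :=
  RExp (RMul (RGet 1 (NLit 0)) (RGet 0 i)).

(* Array 2 holds [esym x i j] in cell [j]. Cells are overwritten from the top on
   insertion and from the bottom on removal, so that each update reads the
   neighbour from the right stage of the recurrence. *)
Definition insert_cell : cmd :=
  SetR 2 (NSub (NAdd (NVar 0) (NLit 1)) (NVar 3))
    (RAdd (RGet 2 (NSub (NAdd (NVar 0) (NLit 1)) (NVar 3)))
       (RMul (xexp (NVar 2)) (RGet 2 (NSub (NVar 0) (NVar 3))))).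

Definition insert_weight : cmd :=
  For 3 (NAdd (NVar 0) (NLit 1)) insert_cell.

(** Loop variables only count upwards; this reflection of variable 2 makes the removals go from the
    last index down. *)
Definition last_index : nexp := NSub (NSub (NVar 1) (NVar 2)) (NLit 1).

Definition remove_cell : cmd :=
  SetR 2 (NAdd (NVar 3) (NLit 1))
    (RSub (RGet 2 (NAdd (NVar 3) (NLit 1)))
       (RMul (xexp last_index) (RGet 2 (NVar 3)))).

Definition remove_weight : cmd :=
  For 3 (NAdd (NVar 0) (NLit 1)) remove_cell.

(** Evaluated after the removal, when the array is already at stage [m]; the denominator rebuilds
    the entry of stage [m.+1] by the recurrence. *)
Definition inclusion_prob : rexp :=
  RDiv (RMul (xexp last_index) (RGet 2 (NVar 0)))
    (RAdd (RGet 2 (NAdd (NVar 0) (NLit 1)))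
       (RMul (xexp last_index) (RGet 2 (NVar 0)))).

Definition draw : cmd :=
  Seq (Toss 4 inclusion_prob)
    (If (NLt (NLit 0) (NVar 4))
       (Seq (Select last_index) (SetN 0 (NSub (NVar 0) (NLit 1))))
       Skip).

(* Variable 0 counts the elements still to be selected. The [If] keeps the
   running time bounded when [k = 0]. *)
Definition sampler : cmd :=
  If (NLt (NLit 0) (NVar 0))
    (Seq (SetR 2 (NLit 1) (RLit 1))
       (Seq (For 2 (NVar 1) insert_weight)
          (For 2 (NVar 1) (Seq remove_weight draw))))
    Skip.

(** * Correctness and cost of the table updates *)

Definition frame (R : realType) (eps : R) (W : nat -> R) (D : nat -> bool)
    (r N i : nat) (s : state R) : Prop :=
  [/\ nvar s 0 = r, nvar s 1 = N & nvar s 2 = i] /\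
  [/\ rarr s 0 = W, rarr s 1 0 = eps & selected s = D].

Lemma insert_weight_det (R : realType) (eps : R) (W : nat -> R)
    (D : nat -> bool) (k N i : nat) (s : state R) :
  let x := fun l => expR (eps * W l) in
  frame eps W D k N i s ->
  (forall l, (l <= k.+1)%N -> rarr s 2 l = esym x i l) ->
  det (exec insert_weight s) (40 * k.+1)%N (fun s' =>
    frame eps W D k N i s' /\
    (forall l, (l <= k.+1)%N -> rarr s' 2 l = esym x i.+1 l)).
Proof.
move=> x fs As.
(* Iteration [j] writes cell [k.+1 - j], so before it exactly the cells above that one are at the
   new stage. Cell 0 is never written: it is 0 at every stage. *)
pose I j s' := frame eps W D k N i s' /\
  (forall l, (l <= k.+1)%N -> rarr s' 2 l =
     if (l <= k.+1 - j)%N then esym x i l else esym x i.+1 l).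
have k0 : nvar s 0 = k by case: fs => -[].
have I0 : I 0%N s.
  by split=> // l lk; rewrite subn0 lk As.
have bnd : neval s (NAdd (NVar 0) (NLit 1)) = k.+1 by rewrite /= k0 addn1.
(* A cell update costs less than 30; the tick per iteration and the loop header fit into the
   remaining slack of 40. *)
apply: det_weaken (det_For (I := I) (c := 30) bnd _ I0); first by rewrite /=; lia.
  move=> s' [fs' As']; split=> // l lk; rewrite As' // subnn leqn0.
  by case: eqP => // ->; rewrite !esym0.
move=> j s' jk [[[e0 e1 e2] [E0 E1 E2]] As']; split=> //=; split=> //.
move=> l lk /=; rewrite /upd /= e0 e2 E0 E1 addn1.
case: eqP => [->|lne].
  rewrite !As'; try lia.
  have -> : (k.+1 - j = (k - j).+1)%N by lia.
  have -> : ((k - j).+1 <= k.+1 - j.+1)%N = false by lia.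
  by rewrite leqnn leqnSn.
rewrite As' //.
have -> // : (l <= k.+1 - j.+1)%N = (l <= k.+1 - j)%N by lia.
Qed.

Lemma remove_weight_det (R : realType) (eps : R) (W : nat -> R)
    (D : nat -> bool) (r N i m : nat) (s : state R) :
  let x := fun l => expR (eps * W l) in
  (i + m.+1)%N = N ->
  frame eps W D r N i s ->
  (forall l, (l <= r.+1)%N -> rarr s 2 l = esym x m.+1 l) ->
  det (exec remove_weight s) (40 * r.+1)%N (fun s' =>
    frame eps W D r N i s' /\
    (forall l, (l <= r.+1)%N -> rarr s' 2 l = esym x m l)).
Proof.
move=> x iN fs As.
pose I j s' := frame eps W D r N i s' /\
  (forall l, (l <= r.+1)%N -> rarr s' 2 l =
     if (l <= j)%N then esym x m l else esym x m.+1 l).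
have r0 : nvar s 0 = r by case: fs => -[].
have I0 : I 0%N s.
  split=> // l lr; rewrite leqn0 As //.
  by case: eqP => // ->; rewrite !esym0.
have bnd : neval s (NAdd (NVar 0) (NLit 1)) = r.+1 by rewrite /= r0 addn1.
apply: det_weaken (det_For (I := I) (c := 30) bnd _ I0); first by rewrite /=; lia.
  by move=> s' [fs' As']; split=> // l lr; rewrite As' // lr.
move=> j s' jr [[[e0 e1 e2] [E0 E1 E2]] As']; split=> //=; split=> //.
move=> l lr /=; rewrite /upd /= e1 e2 E0 E1 addn1.
case: eqP => [->|lne].
  rewrite !As'; try lia.
  have -> : (N - i - 1)%N = m by lia.
  by rewrite ltnn !leqnn esymS addrK.
rewrite As' //.
have -> // : (l <= j.+1)%N = (l <= j)%N by lia.
Qed.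

Lemma build_table_det (R : realType) (eps : R) (W : nat -> R)
    (D : nat -> bool) (k N : nat) (s : state R) :
  let x := fun l => expR (eps * W l) in
  frame eps W D k N 0 s ->
  (forall l, rarr s 2 l = esym x 0 l) ->
  det (exec (For 2 (NVar 1) insert_weight) s) (2 + N * (40 * k.+1).+1)%N
    (fun s' => (exists i, frame eps W D k N i s') /\
       (forall l, (l <= k.+1)%N -> rarr s' 2 l = esym x N l)).
Proof.
move=> x fs As.
(* The counter is existential because its final value is [N.-1], or the initial 0 if the loop is
   empty. *)
pose I i s' := (exists i', frame eps W D k N i' s') /\
  (forall l, (l <= k.+1)%N -> rarr s' 2 l = esym x i l).
have N1 : nvar s 1 = N by case: fs => -[].
have I0 : I 0%N s by split=> //; exists 0%N.
apply: det_weaken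
  (det_For (I := I) (c := (40 * k.+1)%N) (N1 : neval s (NVar 1) = N) _ I0) => //.
move=> i s' _ [[i' [[e0 e1 e2] [E0 E1 E2]]] As'].
have fi : frame eps W D k N i (set_nvar s' 2 i) by [].
apply: det_weaken (insert_weight_det fi As') => // s'' [fs'' As''].
by split=> //; exists i.
Qed.

(** * The law of the selected set *)

Definition agree (N : nat) (S : {set 'I_N}) (D : nat -> bool) (m : nat) :
    bool :=
  [forall e : 'I_N, (m <= e)%N ==> (D e == (e \in S))].

Definition sel (N : nat) (S : {set 'I_N}) (l : nat) : bool :=
  oapp (fun e => e \in S) false (insub l).

Lemma sel_val (N : nat) (S : {set 'I_N}) (e : 'I_N) : sel S e = (e \in S).
Proof. by rewrite /sel valK. Qed.

Lemma agreeS (N : nat) (S : {set 'I_N}) (D : nat -> bool) (m : nat) :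
  (m < N)%N -> agree S D m = (D m == sel S m) && agree S D m.+1.
Proof.
move=> mN; apply/forallP/andP => [H|[Dm /forallP H] e].
  split; first by have := H (Ordinal mN); rewrite leqnn -sel_val.
  by apply/forallP => e; apply/implyP => me; have := H e; rewrite ltnW.
rewrite leq_eqVlt; apply/implyP => /orP[/eqP me|me].
  by rewrite -sel_val -me.
by have := H e; rewrite me.
Qed.

Lemma eq_agree (N : nat) (S : {set 'I_N}) (D D' : nat -> bool) (m : nat) :
  (forall l, (m <= l)%N -> D l = D' l) -> agree S D m = agree S D' m.
Proof.
move=> DD'; apply: eq_forallb => e.
by case: leqP => //= /DD' ->.
Qed.

Lemma agree0 (R : realType) (N : nat) (S : {set 'I_N}) (s : state R) :
  (output N s == S) = agree S (selected s) 0.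
Proof.
apply/eqP/forallP => [<- e|H]; first by rewrite inE eqxx.
by apply/setP => e; rewrite inE; apply/eqP/H.
Qed.

(* The target law, for subsets of size [r] of [0, ..., m.-1]. *)
Definition law (R : realType) (x : nat -> R) (b : nat -> bool) (m r : nat) : R :=
  if (\sum_(l < m) b l)%N == r then
    (\prod_(l < m) if b l then x l else 1) / esym x m r.+1
  else 0.

(** The numerator [esym x m r.+1] of the selection probability cancels the normaliser of [law] at
    [m]; it is nonzero because [r <= m]. *)
Lemma law_in (R : realType) (x : nat -> R) (b : nat -> bool) (m r : nat) :
  (forall i, 0 < x i) -> b m -> (r <= m)%N ->
  x m * esym x m r.+1 / esym x m.+1 r.+2 * law x b m r = law x b m.+1 r.+1.
Proof.
move=> x0 bm rm; rewrite /law !big_ord_recr /= bm addn1 eqSS.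
case: ifP => _; last by rewrite mulr0.
have := esym_gt0 x0 rm; have : 0 < esym x m.+1 r.+2 by apply: esym_gt0.
rewrite esymS => /lt0r_neq0 h1 /lt0r_neq0 h2.
by field; rewrite h1 h2.
Qed.

(** By the recurrence the complementary probability is [esym x m r.+1 / esym x m.+1 r.+1], and its
    numerator cancels as before. *)
Lemma law_out (R : realType) (x : nat -> R) (b : nat -> bool) (m r : nat) :
  (forall i, 0 < x i) -> ~~ b m -> (r <= m)%N ->
  (1 - x m * esym x m r / esym x m.+1 r.+1) * law x b m r = law x b m.+1 r.
Proof.
move=> x0 /negPf bm rm; rewrite /law !big_ord_recr /= bm addn0 mulr1.
case: ifP => _; last by rewrite mulr0.
have := esym_gt0 x0 rm; have : 0 < esym x m.+1 r.+1.
  by apply: esym_gt0 => //; lia.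
rewrite esymS => /lt0r_neq0 h1 /lt0r_neq0 h2.
by field; rewrite h1 h2.
Qed.

Lemma sum_bool_le (b : nat -> bool) (m : nat) : (\sum_(l < m) b l <= m)%N.
Proof.
rewrite -[leqRHS](card_ord m) -sum1_card.
by apply: leq_sum => l _; apply: leq_b1.
Qed.

Lemma clamp_id (R : realType) (p : R) : 0 <= p <= 1 -> clamp p = p.
Proof. by case/andP=> p0 p1; rewrite /clamp min_r // max_r. Qed.

Lemma inclusion_prob_itv (R : realType) (x : nat -> R) (m r : nat) :
  (forall i, 0 < x i) -> (r <= m.+1)%N ->
  0 <= x m * esym x m r / esym x m.+1 r.+1 <= 1.
Proof.
move=> x0 rm; have e0 := esym_gt0 x0 rm.
apply/andP; split.
  by rewrite divr_ge0 ?mulr_ge0 ?esym_ge0 // ltW.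
by rewrite ler_pdivrMr // mul1r esymS lerDr esym_ge0.
Qed.

(** * The sampling loop *)

Lemma prob_draw (R : realType) (A : Type) (E : pred A) (s : state R)
    (f : state R -> rcomp R A) (p := clamp (reval s inclusion_prob)) :
  prob E (rbind (exec draw s) f) =
    p * prob E (f (set_nvar (set_selected (set_nvar s 4 1)
                    (neval s last_index)) 0 (nvar s 0 - 1)%N)) +
    (1 - p) * prob E (f (set_nvar s 4 0)).
Proof. by []. Qed.

Lemma time_draw (R : realType) (A : Type) (s : state R)
    (f : state R -> rcomp R A) :
  (time (rbind (exec draw s) f) <= 60 +
    maxn (time (f (set_nvar (set_selected (set_nvar s 4 1)
                    (neval s last_index)) 0 (nvar s 0 - 1)%N)))
      (time (f (set_nvar s 4 0))))%N.
Proof.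
set t1 := time (f _); set t0 := time (f _).
(* After the toss, both branches pay 4 for the test; one then pays for [Select] and the decrement,
   the other for [Skip]. *)
change ((rcost inclusion_prob).+1 +
  maxn (4 + ((ncost last_index).+1 + (4 + t1))) (4 + (1 + t0)) <=
  60 + maxn t1 t0)%N.
by rewrite /=; lia.
Qed.

(** Induction on the number [m] of undecided indices; those from [m] on are decided and recorded in
    [D]. Worst-case time also counts branches of probability zero, where [r] may exceed [m], so only
    the probability claim assumes [r <= m]. *)
Lemma sampling_loop (R : realType) (eps : R) (W : nat -> R) (N k m i r i' : nat)
    (S : {set 'I_N}) (D : nat -> bool) (s : state R) :
  let x := fun l => expR (eps * W l) in
  let t := run_for (exec (Seq remove_weight draw)) 2 i m s in
  (i + m)%N = N -> (r <= k)%N ->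
  frame eps W D r N i' s ->
  (forall l, (l <= r.+1)%N -> rarr s 2 l = esym x m l) ->
  (forall l, (l < m)%N -> D l = false) ->
  (time t <= m * (40 * k.+1 + 61))%N /\
  ((r <= m)%N -> prob (fun s => output N s == S) t =
     (agree S D m)%:R * law x (sel S) m r).
Proof.
move=> x; have x0 l : 0 < x l by exact: expR_gt0.
elim: m i r i' D s => [|m IH] i r i' D s t iN rk fs As D0; rewrite {}/t.
  split=> //=; rewrite leqn0 => /eqP ->.
  case: fs => _ [_ _ Ds].
  by rewrite agree0 Ds /law !big_ord0 /= invr1 !mulr1.
have f1 : frame eps W D r N i (set_nvar s 2 i).
  by case: fs => -[? ? ?] [].
have [s1 [[fs1 As1] pE tE]] := det_run (remove_weight_det iN f1 As).
cbn [run_for exec time prob]; rewrite rbindA pE.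
set s2 := set_nvar (set_selected (set_nvar s1 4 1) (neval s1 last_index)) 0
  (nvar s1 0 - 1)%N.
set s3 := set_nvar s1 4 0.
case: (fs1) => -[e0 e1 e2] [E0 E1 E2].
have lastE : neval s1 last_index = m by rewrite /= e1 e2; lia.
have f2 : frame eps W (upd D m true) r.-1 N i s2.
  by rewrite /s2 lastE e0 subn1; split=> //=; rewrite E2.
have f3 : frame eps W D r N i s3 by [].
have iN' : (i.+1 + m)%N = N by lia.
have [|||t2 p2] := IH i.+1 r.-1 i (upd D m true) s2 iN' _ f2.
- lia.
- by move=> l lr; apply: As1; lia.
- by move=> l lm; rewrite /upd; case: eqP => [|_]; [lia | apply: D0; lia].
have [|t3 p3] := IH i.+1 r i D s3 iN' rk f3 As1.
  by move=> l lm; apply: D0; lia.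
split=> [|rm].
  (* The 61 is the loop tick plus the 60 allowed for [draw]. *)
  rewrite add1n (leq_ltn_trans (tE _ _)) //.
  rewrite (leq_ltn_trans (leq_add (leqnn _) (time_draw _ _))) //.
  have rk' : (40 * r.+1 <= 40 * k.+1)%N by rewrite leq_mul2l.
  have t23 : (maxn (time (run_for (exec (Seq remove_weight draw)) 2 i.+1 m s2))
      (time (run_for (exec (Seq remove_weight draw)) 2 i.+1 m s3))
      <= m * (40 * k.+1 + 61))%N.
    by rewrite geq_max t2 t3.
  apply: (leq_ltn_trans (leq_add rk' (leq_add (leqnn 60) t23))).
  by rewrite mulSn; set c := (m * _)%N; lia.
rewrite prob_draw -/s2 -/s3.
have -> : reval s1 inclusion_prob = x m * esym x m r / esym x m.+1 r.+1.
  rewrite esymS /inclusion_prob /xexp; cbn [reval].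
  by rewrite lastE /= e0 E0 E1 addn1 !As1.
rewrite clamp_id ?inclusion_prob_itv //.
have mN : (m < N)%N by lia.
(* Only the branch that treats [m] as [S] does can still produce [S]. *)
have ag2 : agree S (upd D m true) m = sel S m && agree S D m.+1.
  rewrite agreeS // {1}/upd eqxx eq_sym eqb_id; congr (_ && _).
  by apply: eq_agree => l lm; rewrite /upd; case: eqP => // lE; lia.
have ag3 : agree S D m = ~~ sel S m && agree S D m.+1.
  by rewrite agreeS // D0 // eq_sym eqbF_neg.
case bm : (sel S m).
  have -> : (1 - x m * esym x m r / esym x m.+1 r.+1) *
      prob (fun s => output N s == S)
        (run_for (exec (Seq remove_weight draw)) 2 i.+1 m s3) = 0.
    (* If [r = m.+1], every remaining index must be taken: [esym x m m.+2] vanishes, so skipping has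
       probability zero. *)
    have [rm'|rm'] := leqP r m; first by rewrite p3 // ag3 bm !mul0r mulr0.
    have -> : r = m.+1 by lia.
    have := @esym_gt0 _ x m.+1 m.+1 x0 (leqnn _).
    rewrite esymS (@esym_eq0 _ x m m.+1) // add0r => /lt0r_neq0 h.
    by rewrite divff // subrr mul0r.
  rewrite addr0; have [r0|r0] := posnP r.
    by rewrite r0 esym0 mulr0 !mul0r /law big_ord_recr /= bm addn1 mulr0.
  have rm' : (r.-1 <= m)%N by lia.
  have := law_in x0 bm rm'; rewrite prednK // => <-.
  by rewrite p2 // ag2 bm /= mulrCA.
have -> : x m * esym x m r / esym x m.+1 r.+1 *
    prob (fun s => output N s == S)
      (run_for (exec (Seq remove_weight draw)) 2 i.+1 m s2) = 0.
  case: (posnP r) => [->|r0]; first by rewrite esym0 mulr0 !mul0r.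
  by rewrite p2 ?ag2 ?bm ?mul0r ?mulr0 //; lia.
rewrite add0r; have [rm'|rm'] := leqP r m.
  rewrite p3 // ag3 bm /= -(@law_out _ x _ m r) ?bm //.
  by rewrite mulrCA.
(* Skipping has probability zero again, and [law] vanishes as well, since [S] omits [m] and has at
   most [m] elements below it. *)
have -> : r = m.+1 by lia.
have := @esym_gt0 _ x m.+1 m.+1 x0 (leqnn _).
rewrite esymS (@esym_eq0 _ x m m.+1) // add0r => /lt0r_neq0 h.
rewrite divff // subrr mul0r /law big_ord_recr /= bm addn0.
case: eqP => [cm|_]; last by rewrite mulr0.
by have := sum_bool_le (sel S) m; rewrite cm ltnn.
Qed.

(** * Assembling the sampler *)

Lemma law_expweight (R : realType) (eps : R) (N k : nat) (w : 'I_N -> R)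
    (S : {set 'I_N}) (x := fun l => expR (eps * oapp w 0 (insub l))) :
  law x (sel S) N k =
    if #|S| == k then expweight eps w S / esym x N k.+1 else 0.
Proof.
rewrite /law /expweight.
have -> : (\sum_(l < N) sel S l = #|S|)%N.
  rewrite -sum1_card [RHS]big_mkcond /=; apply: eq_bigr => e _.
  by rewrite sel_val; case: (e \in S).
have -> // : \prod_(l < N) (if sel S l then x l else 1) =
    \prod_(e in S) expR (eps * w e).
rewrite [RHS]big_mkcond /=; apply: eq_bigr => e _.
by rewrite sel_val /x valK.
Qed.

Lemma sampler_pos (R : realType) (eps : R) (N k : nat) (w : 'I_N -> R)
    (S : {set 'I_N}) (x := fun l => expR (eps * oapp w 0 (insub l))) :
  (0 < k <= N)%N ->
  prob (pred1 S) (sample sampler eps k w) = law x (sel S) N k /\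
  (time (sample sampler eps k w) <= 12 + N * (80 * k.+1 + 62))%N.
Proof.
case/andP=> k0 kN; rewrite /sample prob_rbind_leaf time_rbind_leaf.
set s1 := set_rarr (input eps k w) 2 1 1.
have f1 : frame eps (fun l => oapp w 0 (insub l)) (fun _ => false) k N 0 s1.
  by [].
(* Array 2 starts at zero, so writing 1 to cell 1 yields the table of the empty family. *)
have A1 l : rarr s1 2 l = esym x 0 l.
  by rewrite /= /upd; case: l => [|[]].
set loop := For 2 (NVar 1) (Seq remove_weight draw).
have execE : exec sampler (input eps k w) = Tick 4 (Tick 3
    (rbind (exec (For 2 (NVar 1) insert_weight) s1) (exec loop))).
  by rewrite /= k0.
rewrite execE.
have [s2 [[[i f2] A2] pE tE]] := det_run (build_table_det f1 A1).
case: (f2) => -[_ e1 _] _.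
have loopE : exec loop s2 =
    Tick 2 (run_for (exec (Seq remove_weight draw)) 2 0 N s2).
  by rewrite -e1.
have [|t p] := @sampling_loop _ _ _ N k N 0 k i S _ s2 (add0n N) (leqnn k) f2 A2.
  by [].
split.
  cbn [prob]; rewrite pE loopE [LHS]p //.
  (* No index is decided at the start, so agreement is vacuous. *)
  have -> : agree S (fun _ => false) N; last by rewrite mul1r.
  by apply/forallP => e; rewrite leqNgt ltn_ord.
have tt := tE _ (exec loop); rewrite loopE in tt.
cbn [time].
apply: (leq_trans (leq_add (leqnn 4) (leq_add (leqnn 3) tt))).
cbn [time].
apply: (leq_trans (leq_add (leqnn 4) (leq_add (leqnn 3) (leq_add (leqnn _)
  (leq_add (leqnn 2) t))))).
by nia.
Qed.

Unset Implicit Arguments.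
Set Strict Implicit.

Theorem theorem3p2 (R : realType) (eps : R) (heps : 0 < eps) :
  exists (TS : cmd) (C : nat),
    forall (n k : nat) (w : 'I_'C(n, 2) -> R),
      (k <= 'C(n, 2))%N ->
      (forall e, 0 <= w e) ->
      (forall S : {set 'I_'C(n, 2)},
         prob (pred1 S) (sample TS eps k w) = target eps k w S) /\
      (time (sample TS eps k w) <= C * maxn 1 (k * n ^ 2))%N.
Proof.
(* For [k] and [N] positive, [12 + N * (80 * k.+1 + 62)] is at most [234 * (k * N)], rounded up to
   250. *)
exists sampler, 250%N => n k w kN w0; set N := 'C(n, 2) in w kN w0 *.
set x := fun l => expR (eps * oapp w 0 (insub l)).
have xpos l : 0 < x l by exact: expR_gt0.
have Nn : (N <= n ^ 2)%N.
  by rewrite /N bin2; have := leq_half_double (n * n.-1) (n ^ 2); nia.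
case: (posnP k) => [-> {kN}|k0].
  (* For [k = 0] the empty set is the only candidate, with weight the empty product 1. *)
  split=> //; apply: (@target_of_proportional _ _ _ _ _ _ 1) => [|S].
    exact: oner_neq0.
  rewrite divr1 cards_eq0 /= /output /=.
  have -> : [set _ : 'I_N | false] = set0 by apply/setP => e; rewrite !inE.
  rewrite eq_sym; case: eqP => // ->.
  by rewrite /expweight big_set0.
have k0N : (0 < k <= N)%N by rewrite k0.
split.
  apply: (@target_of_proportional _ _ _ _ _ _ (esym x N k.+1)) => [|S].
    exact/lt0r_neq0/esym_gt0.
  by rewrite (sampler_pos eps w S k0N).1 law_expweight.
apply: leq_trans (sampler_pos eps w set0 k0N).2 _.
rewrite (maxn_idPr _); last by nia.
have : (k * N <= k * n ^ 2)%N by rewrite leq_mul2l Nn orbT.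
by nia.
Qed.
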